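(* Let $A\in\mathcal M_d(\mathbb C)$, $s\in(\mathbb R^d_{\ge 0})^\downarrow$ and let $N$ be a strictly convex unitarily invariant norm on $\mathcal M_d(\mathbb C)$. If $B$ is a local minimizer of $\Psi:\mathcal V_s\to\mathbb R_{\ge0}$, $\Psi(C)=N(A-C)$, in $\mathcal V_s$, then $A$ and $B$ have a joint singular value decomposition, i.e., there exist $U,V\in\mathcal U(d)$ such that $$A=U^*D_{s(A)}V\quad\text{and}\quad B=U^*D_{s(B)}V.$$ In particular, $s(A-B)=|s(A)-s(B)|^\downarrow$ and $B$ is a global minimizer of $\Psi$ in $\mathcal V_s$.
   Context: $\mathcal M_d(\mathbb C)$ is the algebra of complex $d\times d$ matrices and $\mathcal U(d)$ the group of unitary matrices. For $x\in\mathbb R^d$, $x^\downarrow$ is the vector obtained by rearranging the entries of $x$ in non-increasing order, $|x|=(|x_i|)_i$, and $(\mathbb R^d_{\ge0})^\downarrow=\{x^\downarrow:x\in\mathbb R^d_{\ge0}\}$. $D_x$ is the diagonal matrix with main diagonal $x$. For $B\in\mathcal M_d(\mathbb C)$, $s(B)\in(\mathbb R^d_{\ge0})^\downarrow$ is the vector of singular values of $B$ (eigenvalues of $(B^*B)^{1/2}$, counting multiplicities, in non-increasing order). A norm $N$ is unitarily invariant if $N(UAV)=N(A)$ for all $A\in\mathcal M_d(\mathbb C)$ and $U,V\in\mathcal U(d)$. The set $\mathcal V_s=\{C\in\mathcal M_d(\mathbb C):s(C)=s\}$ is endowed with the metric induced by the spectral norm. *)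

(* Defs.v *)
From mathcomp Require Import all_boot all_order all_algebra.
From mathcomp Require Import classical_sets reals complex.

Set Implicit Arguments.
Unset Strict Implicit.
Unset Printing Implicit Defensive.

Import Order.TTheory GRing.Theory Num.Theory.
Local Open Scope ring_scope.
Local Open Scope classical_set_scope.
Local Open Scope complex_scope.
Local Open Scope sesquilinear_scope.

Section Vectors.
Variables (R : realType) (d : nat).
Implicit Types x : 'rV[R]_d.

Definition vdown x : 'rV[R]_d :=
  \row_(j < d) (sort >=%R [seq x 0 i | i : 'I_d])`_j.

Lemma perm_vdown x :
  perm_eq [seq vdown x 0 j | j : 'I_d] [seq x 0 i | i : 'I_d].
Proof.
rewrite perm_sym -(perm_sort >=%R); set t := sort _ _.
have st : size t = d by rewrite size_sort size_map size_enum_ord.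
suff -> : [seq vdown x 0 j | j : 'I_d] = t by [].
apply: (@eq_from_nth _ 0) => [|k]; rewrite size_map size_enum_ord ?st// => kd.
by rewrite (nth_map (Ordinal kd)) ?size_enum_ord// mxE nth_enum_ord.
Qed.

Lemma vdown_noninc x (i j : 'I_d) : (i <= j)%N -> vdown x 0 j <= vdown x 0 i.
Proof.
move=> ij; rewrite !mxE; set t := sort _ _.
have st : size t = d by rewrite size_sort size_map size_enum_ord.
apply: (@sorted_leq_nth _ >=%R) => //; rewrite ?inE ?st//.
- by move=> a b c /= ba cb; exact: le_trans cb ba.
- by move=> a /=.
- by apply: sort_sorted => a b; exact: le_total.
Qed.

Definition vabs x : 'rV[R]_d := \row_(j < d) `|x 0 j|.

Definition nonneg_down : set 'rV[R]_d :=
  [set vdown x | x in [set x : 'rV[R]_d | forall i, 0 <= x 0 i]].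

Definition Dmx x : 'M[R[i]]_d := diag_mx (map_mx (real_complex R) x).

End Vectors.

Section SingularValues.
Variable R : realType.

(* The square root through the library's spectral decomposition H = P^-1 diag(D) P
   with P unitary; meaningful when H is positive semidefinite. *)
Definition sqrtmx d (H : 'M[R[i]]_d) : 'M[R[i]]_d :=
  invmx (spectralmx H) *m diag_mx (map_mx sqrtC (spectral_diag H))
    *m spectralmx H.

(* (B^* B)^(1/2): by absmx_sqr, absmx_herm and eigvals_absmx_ge0 below, the
   positive semidefinite square root of B^* B. *)
Definition absmx d (B : 'M[R[i]]_d) : 'M[R[i]]_d := sqrtmx (B^t* *m B).

(* With multiplicity, in unspecified order. *)
Definition eigvals d (M : 'M[R[i]]_d) : seq R[i] :=
  sval (closed_field_poly_normal (char_poly M)).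

(* The eigenvalues of absmx B are real (see eigvals_absmx_ge0), so taking real
   parts only changes their type. *)
Definition singvals d (B : 'M[R[i]]_d) : 'rV[R]_d :=
  vdown (\row_(j < d) complex.Re (eigvals (absmx B))`_j).

(* The largest singular value; the entries are nonnegative, so starting the
   maximum at 0 only matters for d = 0. *)
Definition spectral_norm d (B : 'M[R[i]]_d) : R :=
  \big[Num.max/0]_(i < d) singvals B 0 i.

Lemma eigvalsE d (M : 'M[R[i]]_d) :
  char_poly M = \prod_(z <- eigvals M) ('X - z%:P).
Proof.
rewrite /eigvals; case: closed_field_poly_normal => r /= {1}->.
by rewrite (monicP (char_poly_monic M)) scale1r.
Qed.

Lemma size_eigvals d (M : 'M[R[i]]_d) : size (eigvals M) = d.
Proof.
have := size_char_poly M; rewrite eigvalsE size_prod_XsubC => -[]; exact.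
Qed.

Lemma gram_normal d (B : 'M[R[i]]_d) : B^t* *m B \is normalmx.
Proof.
apply/hermitian_normalmx/is_hermitianmxP; rewrite expr0 scale1r.
by rewrite trmx_mul map_mxM trmxCK.
Qed.

Lemma gram_diag_ge0 d (B : 'M[R[i]]_d) j :
  0 <= spectral_diag (B^t* *m B) 0 j.
Proof.
set H := B^t* *m B; set P := spectralmx H.
have Pu : P \is unitarymx := spectral_unitarymx H.
have HE : H = invmx P *m diag_mx (spectral_diag H) *m P.
  exact/orthomx_spectralP/gram_normal.
have : diag_mx (spectral_diag H) = (B *m P^t*)^t* *m (B *m P^t*).
  rewrite trmx_mul map_mxM trmxCK.
  rewrite (_ : _ *m _ = P *m H *m P^t*); last by rewrite /H !mulmxA.
  rewrite [in RHS]HE -(invmx_unitary Pu) !mulmxA mulmxV ?unitarymx_unit//.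
  by rewrite mul1mx mulmxK ?unitarymx_unit.
move=> /matrixP/(_ j j); rewrite !mxE eqxx mulr1n => ->.
by apply: sumr_ge0 => k _; rewrite !mxE mulrC mul_conjC_ge0.
Qed.

Lemma absmx_sqr d (B : 'M[R[i]]_d) : absmx B *m absmx B = B^t* *m B.
Proof.
rewrite /absmx [RHS](orthomx_spectralP (gram_normal B)).
rewrite /sqrtmx; set H := B^t* *m B; rewrite !mulmxA mulmxK ?spectral_unit//.
congr (_ *m _); rewrite -mulmxA mulmx_diag; congr (_ *m diag_mx _).
by apply/rowP => j; rewrite !mxE -expr2 sqrtCK.
Qed.

Lemma absmx_herm d (B : 'M[R[i]]_d) : (absmx B)^t* = absmx B.
Proof.
rewrite /absmx /sqrtmx; set H := B^t* *m B.
rewrite invmx_unitary ?spectral_unitarymx// !trmx_mul !map_mxM trmxCK mulmxA.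
congr (_ *m _ *m _); rewrite tr_diag_mx map_diag_mx; congr diag_mx.
apply/rowP => j; rewrite !mxE; apply/CrealP/ger0_real.
by rewrite sqrtC_ge0 gram_diag_ge0.
Qed.

Lemma eigvals_absmx_ge0 d (B : 'M[R[i]]_d) z :
  z \in eigvals (absmx B) -> 0 <= z.
Proof.
rewrite -root_prod_XsubC -eigvalsE -eigenvalue_root_char.
rewrite /absmx /sqrtmx; set H := B^t* *m B; set P := spectralmx H.
set D := map_mx sqrtC (spectral_diag H) => /eigenvalueP[v vE vN0].
set w := v *m invmx P.
have wE : w *m diag_mx D = z *: w.
  by rewrite scalemxAl -vE !mulmxA mulmxK ?spectral_unit.
have [j wj] : exists j, w 0 j != 0.
  apply/rV0Pn; apply: contraNneq vN0 => w0.
  by rewrite -(mulmxKV (spectral_unit H) v) -/P -/w w0 mul0mx.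
have zE : w 0 j * D 0 j = z * w 0 j.
  by move/rowP/(_ j): wE; rewrite mul_mx_diag [LHS]mxE [RHS]mxE.
have <- : D 0 j = z by apply: (mulIf wj); rewrite mulrC.
by rewrite mxE sqrtC_ge0 gram_diag_ge0.
Qed.

End SingularValues.

Section Norms.
Variables (R : realType) (d : nat).
Implicit Types (N : 'M[R[i]]_d -> R) (A B C U V : 'M[R[i]]_d).

Definition is_norm N : Prop :=
  [/\ forall A, 0 <= N A,
      forall A, N A = 0 -> A = 0,
      forall (a : R[i]) A, N (a *: A) = ComplexField.Normc.normc a * N A
    & forall A B, N (A + B) <= N A + N B].

Definition unitarily_invariant N : Prop :=
  forall A U V, U \is unitarymx -> V \is unitarymx -> N (U *m A *m V) = N A.

(* The unit sphere of N contains no nontrivial segment. *)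
Definition strictly_convex N : Prop :=
  forall A B (t : R), N A = 1 -> N B = 1 -> A <> B -> 0 < t < 1 ->
    N (t%:C *: A + (1 - t)%:C *: B) < 1.

Definition Vset (s : 'rV[R]_d) : set 'M[R[i]]_d := [set C | singvals C = s].

Definition local_minimizer (X : set 'M[R[i]]_d) (f : 'M[R[i]]_d -> R) B : Prop :=
  X B /\ exists2 e : R, 0 < e &
    forall C, X C -> spectral_norm (C - B) < e -> f B <= f C.

Definition global_minimizer (X : set 'M[R[i]]_d) (f : 'M[R[i]]_d -> R) B : Prop :=
  X B /\ forall C, X C -> f B <= f C.

End Norms.

(* Main.v *)
Require Import Defs.
From mathcomp Require Import all_boot all_order all_algebra.
From mathcomp Require Import classical_sets reals complex.
From mathcomp Require Import perm fingroup ring lra.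
From mathcomp Require Import mathcomp_extra boolp topology normedtype derive.
Import Order.TTheory GRing.Theory Num.Theory.
Import numFieldNormedType.Exports.
Local Open Scope ring_scope.
Local Open Scope classical_set_scope.
Local Open Scope complex_scope.
Local Open Scope sesquilinear_scope.

Set Implicit Arguments.
Unset Strict Implicit.
Unset Printing Implicit Defensive.

(** Why the theorem holds.  The set of matrices with the singular values of B
    is the orbit of B under pairs of unitaries, B |-> U B V, so only the
    inequalities N (A - B) <= N (A - U B V), for U B V near B, are used.

    Let 0 < t < 1 and let G = (1 - t) A + t B be a point of the open segment
    from A to B.  If U G V = G, then
      A - U B V = t (A - B) + (1 - t) U (A - B) V,
    a proper convex combination of two matrices with the same norm.  By strict
    convexity a pair close to the identity that fixes G would bring the orbit
    strictly closer to A, unless it fixes B as well (orbit_local_min_stab).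
    Everything about B is extracted from this principle and one variant of it.

    First, if G is diagonal, then D G D^-1 = G for every diagonal unitary D;
    hence D B D^-1 = B when D is near 1, and B is diagonal (stab_diag).  With
    t = 1/2 and a singular value decomposition of the midpoint G, both A and B
    become diagonal in the same pair of bases.  Next, corresponding diagonal
    entries have the same phase, since otherwise rotating an entry of B would shrink an
    entry of A - B, which lowers N (diag_same_phase); as their sums are the
    singular values of 2 G, all entries are nonnegative.  Finally the entries of
    A and B are ordered alike: if a_i < a_j and b_i > b_j, some point of the
    segment has equal entries at i and j, so it is still diagonal after a
    reflection mixing the coordinates i and j, but B is not (diag_same_order).
    As the singular values of G are sorted, those of A and B are too, and this
    is the joint decomposition (orbit_local_min_joint_svd).

    A joint decomposition determines N (A - B) from the singular values of A and
    of B alone (orbit_local_min_dist).  The unitary group being compact, some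
    point of the orbit is a global minimizer (unitary_orbit_min); it is in
    particular a local one, so it lies at the same distance from A as B. *)

(** * Adjoints, unitary matrices and characteristic polynomials *)

Section Adjoint.
Variable C : numClosedFieldType.

Lemma adjmxM m n p (A : 'M[C]_(m, n)) (B : 'M[C]_(n, p)) :
  (A *m B)^t* = B^t* *m A^t*.
Proof. by rewrite trmx_mul map_mxM. Qed.

Lemma adjmx_diag n (z : 'rV[C]_n) : (diag_mx z)^t* = diag_mx (map_mx Num.conj z).
Proof. by rewrite tr_diag_mx map_diag_mx. Qed.

Lemma unitarymxtP n (U : 'M[C]_n) : U \is unitarymx -> U^t* *m U = 1%:M.
Proof. by move=> uU; rewrite -invmx_unitary// mulVmx// unitarymx_unit. Qed.

Lemma mulKmx_unitary m n (U : 'M[C]_n) (A : 'M[C]_(n, m)) :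
  U \is unitarymx -> U^t* *m (U *m A) = A.
Proof. by move=> uU; rewrite mulmxA unitarymxtP// mul1mx. Qed.

Lemma unitarymx1 n : (1%:M : 'M[C]_n) \is unitarymx.
Proof. by apply/unitarymxP; rewrite trmx1 map_mx1 mulmx1. Qed.

Lemma adjmx_unitary n (U : 'M[C]_n) : U \is unitarymx -> U^t* \is unitarymx.
Proof. by rewrite trmxC_unitary. Qed.

Lemma unitary_equivK n (U V X : 'M[C]_n) : U \is unitarymx -> V \is unitarymx ->
  U^t* *m (U *m X *m V) *m V^t* = X.
Proof.
move=> uU uV; rewrite -[U *m X *m V]mulmxA mulKmx_unitary// -mulmxA.
by rewrite (unitarymxP uV) mulmx1.
Qed.

Lemma unitary_equivVK n (U V X : 'M[C]_n) : U \is unitarymx -> V \is unitarymx ->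
  U *m (U^t* *m X *m V^t*) *m V = X.
Proof.
move=> /adjmx_unitary uU /adjmx_unitary uV.
by have := unitary_equivK X uU uV; rewrite !trmxCK.
Qed.

Lemma unitarymx_diag n (z : 'rV[C]_n) :
  (forall i, z 0 i * Num.conj (z 0 i) = 1) -> diag_mx z \is unitarymx.
Proof.
move=> z1; apply/unitarymxP; rewrite adjmx_diag mulmx_diag -diag_const_mx.
by congr diag_mx; apply/rowP => i; rewrite !mxE z1.
Qed.

Lemma char_poly_diag n (z : 'rV[C]_n) :
  char_poly (diag_mx z) = \prod_i ('X - (z 0 i)%:P).
Proof.
rewrite char_poly_trig ?diag_mx_is_trig//.
by apply: eq_bigr => i _; rewrite mxE eqxx.
Qed.

Lemma char_poly_conj n (P A : 'M[C]_n) : P \in unitmx ->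
  char_poly (invmx P *m A *m P) = char_poly A.
Proof.
move=> uP; rewrite /char_poly /char_poly_mx !map_mxM.
set Q := map_mx polyC (invmx P); set P' := map_mx polyC P.
have QP : Q *m P' = 1%:M by rewrite -map_mxM mulVmx// map_mx1.
have -> : 'X%:M - Q *m map_mx polyC A *m P' = Q *m ('X%:M - map_mx polyC A) *m P'.
  rewrite mulmxBr mulmxBl; congr (_ - _).
  by rewrite -scalemx1 -scalemxAr mulmx1 -scalemxAl QP.
by rewrite !det_mulmx mulrAC -det_mulmx QP det1 mul1r.
Qed.

End Adjoint.

(** * Singular values of diagonalized matrices *)

Section SingularValues.
Variables (R : realType) (d : nat).
Implicit Types (x y : 'rV[R]_d) (A B : 'M[R[i]]_d) (z : 'rV[R[i]]_d).
Local Notation normc := ComplexField.Normc.normc.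

Lemma eq_vdown x y :
  perm_eq [seq x 0 i | i : 'I_d] [seq y 0 i | i : 'I_d] -> vdown x = vdown y.
Proof.
have tot : total (>=%R : rel R) by move=> a b; exact: le_total.
have tr : transitive (>=%R : rel R) by move=> a b c /= ba cb; exact: le_trans cb ba.
have asym : antisymmetric (>=%R : rel R) by move=> a b; rewrite andbC; exact: le_anti.
by move=> /(perm_sortP tot tr asym) E; apply/rowP => j; rewrite !mxE E.
Qed.

Lemma map_image (S T : Type) (f : 'I_d -> S) (g : S -> T) :
  [seq g u | u <- [seq f i | i : 'I_d]] = [seq g (f i) | i : 'I_d].
Proof. by rewrite -map_comp. Qed.

Lemma nth_row x (k : 'I_d) : [seq x 0 i | i : 'I_d]`_k = x 0 k.
Proof. by rewrite (nth_map k) ?size_enum_ord// nth_ord_enum. Qed.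

Lemma vdown_id x :
  (forall i j : 'I_d, (i <= j)%N -> x 0 j <= x 0 i) -> vdown x = x.
Proof.
move=> xdown; apply/rowP => j; rewrite mxE sorted_sort ?nth_row//.
  by move=> a b c /= ba cb; exact: le_trans cb ba.
apply/(sortedP 0) => k; rewrite size_map size_enum_ord => kd.
rewrite (nth_row x (Ordinal kd)) (nth_row x (Ordinal (ltnW kd))).
exact: xdown.
Qed.

(** Singular values are read off a spectral decomposition that is only known up
    to a choice; the characteristic polynomial of the Gram matrix determines
    them regardless, because a monic split polynomial determines its multiset of
    roots. *)
Lemma singvals_char_poly B x : (forall i, 0 <= x 0 i) ->
  char_poly (B^t* *m B) = \prod_i ('X - ((x 0 i ^+ 2)%:C)%:P) ->
  singvals B = vdown x.
Proof.
move=> x0 cB; set H := B^t* *m B in cB *.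
have uP := spectral_unit H.
have cD : char_poly H = \prod_i ('X - (spectral_diag H 0 i)%:P).
  have HE : H = _ := orthomx_spectralP (gram_normal B).
  by rewrite {1}HE char_poly_conj// char_poly_diag.
have cS : \prod_(z <- eigvals (absmx B)) ('X - z%:P)
    = \prod_i ('X - (sqrtC (spectral_diag H 0 i))%:P).
  rewrite -eigvalsE /absmx /sqrtmx char_poly_conj// char_poly_diag.
  by apply: eq_bigr => i _; rewrite mxE.
have pD : perm_eq [seq spectral_diag H 0 i | i : 'I_d]
                  [seq ((x 0 i ^+ 2)%:C : R[i]) | i : 'I_d].
  by apply/prod_XsubC_eq; rewrite !big_image -cD -cB.
have pS : perm_eq (eigvals (absmx B)) [seq ((x 0 i)%:C : R[i]) | i : 'I_d].
  have : perm_eq (eigvals (absmx B)) [seq sqrtC (spectral_diag H 0 i) | i : 'I_d].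
    by apply/prod_XsubC_eq; rewrite cS big_image.
  move=> /perm_trans; apply; have := perm_map sqrtC pD; rewrite !map_image.
  suff -> : [seq sqrtC ((x 0 i ^+ 2)%:C : R[i]) | i : 'I_d] = [seq (x 0 i)%:C | i : 'I_d].
    by [].
  by apply: eq_image => // i; rewrite rmorphXn /= sqrCK// ler0c.
apply: eq_vdown; have := perm_map (@complex.Re R) pS; rewrite map_image.
set r := eigvals _; suff -> : [seq (\row_(j < d) complex.Re r`_j) 0 i | i : 'I_d]
                = [seq complex.Re u | u <- r] by [].
have sr : size r = d by rewrite size_eigvals.
apply: (@eq_from_nth _ 0) => [|k]; rewrite size_map size_enum_ord ?size_map// => kd.
rewrite (nth_map (Ordinal kd)) ?size_enum_ord// mxE nth_enum_ord//.
by rewrite (nth_map 0) ?sr.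
Qed.

Lemma singvals_diag (U V : 'M[R[i]]_d) z : U \is unitarymx -> V \is unitarymx ->
  singvals (U *m diag_mx z *m V) = vdown (\row_i normc (z 0 i)).
Proof.
move=> uU uV; apply: singvals_char_poly => [i|].
  by rewrite mxE; case: (z 0 i) => a b /=; exact: sqrtr_ge0.
have -> : (U *m diag_mx z *m V)^t* *m (U *m diag_mx z *m V)
    = invmx V *m (diag_mx (map_mx Num.conj z) *m diag_mx z) *m V.
  rewrite (invmx_unitary uV) !adjmxM adjmx_diag -!mulmxA.
  by rewrite (mulKmx_unitary _ uU).
rewrite (char_poly_conj _ (unitarymx_unit uV)) mulmx_diag char_poly_diag.
apply: eq_bigr => i _; congr ('X - _%:P).
rewrite !mxE; case: (z 0 i) => a b /=.
rewrite sqr_sqrtr ?addr_ge0 ?sqr_ge0// !expr2.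
by apply/eqP; rewrite eq_complex /=; apply/andP; split; apply/eqP; ring.
Qed.
End SingularValues.

(** * The singular value decomposition *)

Section SVD.

Lemma dotmxZ (C : numClosedFieldType) n (a b : C) (u v : 'rV[C]_n) :
  dotmx (a *: u) (b *: v) = a * Num.conj b * dotmx u v.
Proof. by rewrite linearZl_LR linearZr_LR /= mulrA. Qed.

(** The rows are the nonnegative multiples of an orthonormal basis.  Nonzero
    rows only need normalizing; a zero row is first replaced by any nonzero
    vector orthogonal to all rows, which exists because the matrix is then
    singular, and induction on the number of zero rows concludes. *)
Lemma orthogonal_rows_unitary (C : numClosedFieldType) n (Y : 'M[C]_n) :
  (forall i j, i != j -> dotmx (row i Y) (row j Y) = 0) ->
  exists2 W : 'M[C]_n, W \is unitarymx &
    forall i, exists2 a, 0 <= a & row i Y = a *: row i W.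
Proof.
have [k] := ubnP #|[pred i | row i Y == 0]|.
elim: k Y => // k IHk Y; rewrite ltnS => leYk oY.
have [[i0 i00]|nzY] := pselect (exists i0, row i0 Y = 0); last first.
  have dY i : 0 < dotmx (row i Y) (row i Y).
    by apply: dotmx_is_dotmx; apply/eqP => Yi0; apply: nzY; exists i.
  pose W := \matrix_i ((sqrtC (dotmx (row i Y) (row i Y)))^-1 *: row i Y).
  exists W => [|i]; last first.
    exists (sqrtC (dotmx (row i Y) (row i Y))); first by rewrite sqrtC_ge0 ltW.
    by rewrite rowK scalerA divff ?scale1r// sqrtC_eq0 gt_eqF.
  apply/row_unitarymxP => i j; rewrite !rowK dotmxZ.
  have [<-|ij] := eqVneq i j; last by rewrite (oY i j)// mulr0.
  set a := dotmx _ _.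
  have a0 : 0 < a := dY i.
  have s0 : 0 < sqrtC a by rewrite sqrtC_gt0.
  have -> : Num.conj (sqrtC a)^-1 = (sqrtC a)^-1.
    by apply/CrealP/ger0_real; rewrite invr_ge0 ltW.
  rewrite -[X in _ * X](sqrtCK a) expr2.
  by rewrite mulrA mulfVK ?gt_eqF// mulVf// gt_eqF.
have [u u0 uY] : exists2 u : 'rV[C]_n, u != 0 & u *m Y^t* = 0.
  have : kermx (Y^t*) != 0.
    rewrite kermx_eq0 row_free_unit map_unitmx unitmx_tr -row_free_unit.
    apply/negP => fY; have := mulmx_free_eq0 (delta_mx 0 i0 : 'rV[C]_n) fY.
    rewrite -rowE i00 eqxx => /esym/eqP/rowP/(_ i0)/eqP.
    by rewrite !mxE !eqxx oner_eq0.
  by move=> /rowV0Pn[u /sub_kermxP uY u0]; exists u.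
have uYj j : dotmx u (row j Y) = 0.
  rewrite dotmxE; move/rowP/(_ j): uY; rewrite !mxE => h; rewrite -[RHS]h.
  by apply: eq_bigr => l _; rewrite !mxE.
pose Y' := \matrix_i (if i == i0 then u else row i Y).
have [||W uW YW] := IHk Y'.
- apply: leq_trans leYk; apply/proper_card/properP; split.
    apply/fintype.subsetP => i; rewrite !inE rowK; case: (eqVneq i i0) => // _.
    by rewrite (negPf u0).
  by exists i0; rewrite !inE ?i00// rowK eqxx (negPf u0).
- move=> i j; rewrite !rowK; have [->|ii0] := eqVneq i i0; have [ji0|ji0] := eqVneq j i0.
  + by [].
  + by rewrite uYj.
  + move=> _; rewrite -[LHS]conjCK.
    suff -> : Num.conj (dotmx (row i Y) u) = dotmx u (row i Y) by rewrite uYj conjC0.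
    rewrite !dotmxE !mxE rmorph_sum; apply: eq_bigr => l _.
    by rewrite !mxE rmorphM /= conjCK mulrC.
  + exact: oY.
exists W => // i; have [->|ii0] := eqVneq i i0.
  by exists 0 => //; rewrite i00 scale0r.
by have [a a0] := YW i; rewrite rowK (negPf ii0); exists a.
Qed.

Variables (R : realType) (d : nat).
Implicit Types (x : 'rV[R]_d) (A B U V : 'M[R[i]]_d).
Local Notation normc := ComplexField.Normc.normc.

Lemma normc_real (a : R) : 0 <= a -> normc a%:C = a.
Proof. by move=> a0; rewrite /= expr0n addr0 sqrtr_sqr ger0_norm. Qed.

(** If P diagonalizes B B^*, then the rows of P B are pairwise orthogonal. *)
Lemma svd_unsorted B : exists U V x, [/\ U \is unitarymx, V \is unitarymx,
  forall i, 0 <= x 0 i & B = U *m Dmx x *m V].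
Proof.
pose H := B^t*^t* *m B^t*; pose P := spectralmx H.
have uP : P \is unitarymx := spectral_unitarymx H.
have [|W uW YW] := @orthogonal_rows_unitary _ _ (P *m B).
  move=> i j ij; rewrite dotmxE.
  have -> : row i (P *m B) *m (row j (P *m B))^t*
      = row i P *m H *m (row j P)^t*.
    by rewrite /H trmxCK !row_mul !adjmxM !mulmxA.
  have HE : H = _ := orthomx_spectralP (gram_normal (B^t*)).
  have -> : row i P *m H = spectral_diag H 0 i *: row i P.
    rewrite -row_mul {1}HE !mulmxA mulmxV ?unitarymx_unit// mul1mx.
    by rewrite row_mul row_diag_mx -scalemxAl -rowE.
  have Pij : (row i P *m (row j P)^t*) 0 0 = 0.
    by rewrite -dotmxE (row_unitarymxP uP) (negPf ij).
  by rewrite -scalemxAl mxE Pij mulr0.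
have /choice[a aP] : forall i, exists a : R, 0 <= a /\ row i (P *m B) = a%:C *: row i W.
  move=> i; have [z z0 zE] := YW i; exists (complex.Re z).
  rewrite RRe_real ?ger0_real//; split=> //.
  by move: z0; rewrite lecE /= => /andP[].
exists (P^t*), W, (\row_i a i); split; [by rewrite trmxC_unitary|exact: uW| |].
  by move=> i; rewrite mxE; have [] := aP i.
rewrite -mulmxA -[LHS](mulKmx_unitary B uP); congr (_ *m _).
apply/row_matrixP => i; have [_ ->] := aP i.
by rewrite row_mul row_diag_mx -scalemxAl -rowE !mxE.
Qed.

Lemma Dmx_perm x (p : 'S_d) :
  Dmx (\row_i x 0 (p i)) = perm_mx p *m Dmx x *m (perm_mx p)^t*.
Proof.
rewrite /Dmx tr_perm_mx map_perm_mx -row_permE -col_permE.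
apply/matrixP => i j; rewrite !mxE (inj_eq perm_inj); by case: (i == j).
Qed.

Lemma perm_mx_unitary (p : 'S_d) : (perm_mx p : 'M[R[i]]_d) \is unitarymx.
Proof.
by apply/unitarymxP; rewrite tr_perm_mx map_perm_mx -perm_mxM mulgV perm_mx1.
Qed.

Lemma singvals_Dmx U V x : U \is unitarymx -> V \is unitarymx ->
  singvals (U *m Dmx x *m V) = vdown (vabs x).
Proof.
move=> uU uV; rewrite singvals_diag//; congr vdown; apply/rowP => i.
by rewrite !mxE /= expr0n addr0 sqrtr_sqr.
Qed.

Lemma vabs_id x : (forall i, 0 <= x 0 i) -> vabs x = x.
Proof. by move=> x0; apply/rowP => i; rewrite mxE ger0_norm. Qed.

Lemma svd B : exists U V, [/\ U \is unitarymx, V \is unitarymx &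
  B = U *m Dmx (singvals B) *m V].
Proof.
have [U [V [x [uU uV x0 BE]]]] := svd_unsorted B.
have sE : singvals B = vdown x by rewrite {1}BE singvals_Dmx// vabs_id.
have [p pE] : exists p : 'S_d, vdown x = \row_i x 0 (p i).
  have /tuple_permP[p pE] : perm_eq [tuple vdown x 0 i | i < d] [tuple x 0 i | i < d].
    exact: perm_vdown.
  exists p; apply/rowP => i; rewrite [RHS]mxE.
  have /(congr1 (fun s => nth 0 s i)) := pE.
  rewrite nth_row => ->; rewrite (nth_map i) ?size_enum_ord// nth_ord_enum.
  by rewrite tnth_mktuple.
have up := perm_mx_unitary p.
exists (U *m (perm_mx p)^t*), (perm_mx p *m V); split.
- by apply: mul_unitarymx uU _; rewrite trmxC_unitary.
- exact: mul_unitarymx up uV.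
- rewrite sE pE Dmx_perm -!mulmxA !mulKmx_unitary//.
  by rewrite BE -!mulmxA.
Qed.

Lemma singvals_ge0 B i : 0 <= singvals B 0 i.
Proof.
have [U [V [x [uU uV x0 BE]]]] := svd_unsorted B.
rewrite BE singvals_Dmx// vabs_id//.
have : vdown x 0 i \in [seq vdown x 0 j | j : 'I_d] by apply: map_f; rewrite mem_enum.
by rewrite (seq.perm_mem (perm_vdown x)) => /mapP[j _ ->].
Qed.

Lemma singvals_noninc B (i j : 'I_d) : (i <= j)%N ->
  singvals B 0 j <= singvals B 0 i.
Proof. exact: vdown_noninc. Qed.

Lemma singvals_unitary U V B : U \is unitarymx -> V \is unitarymx ->
  singvals (U *m B *m V) = singvals B.
Proof.
move=> uU uV; have [P [Q [uP uQ BE]]] := svd B.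
have -> : U *m B *m V = (U *m P) *m Dmx (singvals B) *m (Q *m V).
  by rewrite {1}BE !mulmxA.
rewrite (singvals_Dmx _ (mul_unitarymx uU uP) (mul_unitarymx uQ uV)).
rewrite vabs_id ?vdown_id//; [exact: singvals_noninc|exact: singvals_ge0].
Qed.

End SVD.

(** * Unitarily invariant norms and orbit-local minimizers *)

Section UnitarilyInvariantNorm.
Variables (R : realType) (d : nat) (N : 'M[R[i]]_d -> R).
Hypotheses (hN : is_norm N) (hUI : unitarily_invariant N).
Implicit Types (A B C U V X Y : 'M[R[i]]_d).
Local Notation normc := ComplexField.Normc.normc.

Lemma uin_ge0 A : 0 <= N A. Proof. by have [] := hN. Qed.

Lemma uin_eq0 A : N A = 0 -> A = 0. Proof. by have [_ + _ _] := hN; apply. Qed.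

Lemma uinZ (a : R[i]) A : N (a *: A) = normc a * N A.
Proof. by have [_ _ + _] := hN; apply. Qed.

Lemma uinD A B : N (A + B) <= N A + N B. Proof. by have [_ _ _] := hN; apply. Qed.

Lemma uin0 : N 0 = 0.
Proof. by rewrite -(scale0r (0 : 'M[R[i]]_d)) uinZ ComplexField.Normc.normc0 mul0r. Qed.

Lemma uinN A : N (- A) = N A.
Proof. by rewrite -scaleN1r uinZ normcN ComplexField.Normc.normc1 mul1r. Qed.

Lemma uin_gt0 A : A <> 0 -> 0 < N A.
Proof. by move=> A0; rewrite lt0r uin_ge0 andbT; apply/eqP => /uin_eq0. Qed.

Lemma uinZr (t : R) A : 0 <= t -> N (t%:C *: A) = t * N A.
Proof. by move=> t0; rewrite uinZ normc_real. Qed.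

Lemma uinUl U A : U \is unitarymx -> N (U *m A) = N A.
Proof. by move=> uU; rewrite -[U *m A]mulmx1; exact: hUI uU (unitarymx1 _ _). Qed.

Lemma uinUr V A : V \is unitarymx -> N (A *m V) = N A.
Proof. by move=> uV; have := hUI A (unitarymx1 _ _) uV; rewrite mul1mx. Qed.

(** The diagonal unitaries moving a single coordinate suffice to detect both
    off-diagonal entries and phases of diagonal entries. *)
Definition phase (i : 'I_d) (z : R[i]) : 'M[R[i]]_d :=
  diag_mx (\row_k if k == i then z else 1).

Lemma phase_unitary i z : z * Num.conj z = 1 -> phase i z \is unitarymx.
Proof.
move=> z1; apply: unitarymx_diag => k; rewrite mxE; case: eqP => // _.
by rewrite conjC1 mulr1.
Qed.

Lemma phase_delta i z : phase i z = 1%:M + (z - 1) *: delta_mx i i.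
Proof.
apply/matrixP => k l; rewrite !mxE.
have [<-|kl] := eqVneq k l; last first.
  rewrite (_ : (k == i) && (l == i) = false) ?mulr0 ?addr0//.
  by apply: contraNF kl => /andP[/eqP-> /eqP->].
by case: eqP => _; rewrite /= ?mulr1 ?mulr0 ?addr0// addrC subrK.
Qed.

(** Closeness in the spectral norm can be tested with N: with D the diagonal
    factor of B, the matrix 2 s_i E_ii is the difference of D and of D with its
    i-th entry negated, two matrices of norm N B, so s_i N(E_ii) <= N B. *)
Lemma spectral_norm_le : exists2 c : R, 0 < c & forall B, spectral_norm B <= c * N B.
Proof.
(* The sum bounds every inverse at once; adding 1 keeps c positive for d = 0. *)
pose c := 1 + \sum_i (N (delta_mx i i))^-1.
have c0 : 0 < c by rewrite ltr_pwDl// sumr_ge0// => i _; rewrite invr_ge0 uin_ge0.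
exists c => // B; apply: bigmax_le => [|i _].
  by rewrite mulr_ge0 ?uin_ge0// ltW.
have E0 : 0 < N (delta_mx i i).
  by apply: uin_gt0 => /matrixP/(_ i i)/eqP; rewrite !mxE eqxx oner_eq0.
have ci : (N (delta_mx i i))^-1 <= c.
  rewrite /c (bigD1 i)//= addrCA ler_wpDr// addr_ge0// sumr_ge0// => j _.
  by rewrite invr_ge0 uin_ge0.
suff h : singvals B 0 i * N (delta_mx i i) <= N B.
  apply: (@le_trans _ _ (N B * (N (delta_mx i i))^-1)).
    by rewrite ler_pdivlMr.
  by rewrite mulrC ler_wpM2r ?uin_ge0.
have [U [V [uU uV BE]]] := svd B.
set s := singvals B in BE *.
have -> : N B = N (Dmx s) by rewrite BE; exact: (hUI (Dmx s) uU uV).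
have pE : (Dmx s) - phase i (-1) *m Dmx s = (s 0 i *+ 2)%:C *: delta_mx i i.
  rewrite phase_delta mulmxDl mul1mx opprD addNKr -scalemxAl -scaleNr.
  have -> : delta_mx i i *m Dmx s = (s 0 i)%:C *: delta_mx i i.
    apply/matrixP => k l; rewrite mul_mx_diag !mxE mulrC.
    by case: (eqVneq l i) => [->|]; rewrite ?andbF ?mulr0.
  by rewrite scalerA; congr (_ *: _); rewrite rmorphMn /=; ring.
have u1 : phase i (-1) \is unitarymx.
  by apply: phase_unitary; rewrite rmorphN rmorph1 mulrNN mulr1.
have := uinD (Dmx s) (- (phase i (-1) *m Dmx s)).
rewrite pE uinN (uinUl _ u1) uinZr ?mulrn_wge0 ?singvals_ge0//.
by rewrite mulrnAl -mulr2n lerMn2r.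
Qed.

(** The part of local minimality that the argument uses, in a form that is
    stable under changing both bases. *)
Definition orbit_local_min A B := exists2 e : R, 0 < e &
  forall U V, U \is unitarymx -> V \is unitarymx ->
    N (U *m B *m V - B) < e -> N (A - B) <= N (A - U *m B *m V).

(** Moving B by unitaries preserves its singular values. *)
Lemma local_minimizer_orbit s A B :
  local_minimizer (Vset s) (fun C => N (A - C)) B -> orbit_local_min A B.
Proof.
move=> [Bs [e e0 eP]]; have [c c0 cP] := spectral_norm_le.
exists (e / c) => [|U V uU uV]; first exact: divr_gt0.
rewrite ltr_pdivlMr// mulrC => h; apply: eP; last exact: le_lt_trans (cP _) h.
by rewrite /Vset /= singvals_unitary.
Qed.

Lemma orbit_local_min_unitary P Q A B : P \is unitarymx -> Q \is unitarymx ->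
  orbit_local_min A B -> orbit_local_min (P *m A *m Q) (P *m B *m Q).
Proof.
move=> uP uQ [e e0 eP]; exists e => // U V uU uV.
have uP' : P^t* \is unitarymx by rewrite trmxC_unitary.
have uQ' : Q^t* \is unitarymx by rewrite trmxC_unitary.
set U' := P^t* *m U *m P; set V' := Q *m V *m Q^t*.
have uU' : U' \is unitarymx by exact: mul_unitarymx (mul_unitarymx uP' uU) uP.
have uV' : V' \is unitarymx by exact: mul_unitarymx (mul_unitarymx uQ uV) uQ'.
have UE : U *m (P *m B *m Q) *m V = P *m (U' *m B *m V') *m Q.
  rewrite /U' /V' !mulmxA (unitarymxP uP) mul1mx.
  by rewrite -[X in _ = X]mulmxA unitarymxtP// mulmx1.
have conjB X Y : N (P *m X *m Q - P *m Y *m Q) = N (X - Y).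
  by rewrite -mulmxBl -mulmxBr; exact: (hUI (X - Y) uP uQ).
have E1 := etrans (congr1 (fun Z => N (Z - P *m B *m Q)) UE) (conjB (U' *m B *m V') B).
have E2 := etrans (congr1 (fun Z => N (P *m A *m Q - Z)) UE) (conjB A (U' *m B *m V')).
have := eP U' V' uU' uV'; rewrite -E1 -E2 -(conjB A B); exact.
Qed.

Hypothesis hSC : strictly_convex N.

Lemma uin_strict (t : R) X Y : N X = N Y -> X <> Y -> 0 < t < 1 ->
  N (t%:C *: X + (1 - t)%:C *: Y) < N X.
Proof.
move=> XY neXY t01; have X0 : 0 < N X.
  apply: uin_gt0 => X0; apply: neXY; rewrite X0; apply/esym/uin_eq0.
  by rewrite -XY X0 uin0.
pose r := (N X)^-1; have r0 : 0 < r by rewrite invr_gt0.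
have rC0 : r%:C != 0 :> R[i] by rewrite eq_complex /= gt_eqF.
have rX : N (r%:C *: X) = 1 by rewrite uinZr ?ltW// mulVf// gt_eqF.
have rY : N (r%:C *: Y) = 1 by rewrite uinZr ?ltW// -XY mulVf// gt_eqF.
have neq : r%:C *: X <> r%:C *: Y by move=> /(scalerI rC0).
have := hSC rX rY neq t01.
rewrite !scalerA ![_ * r%:C]mulrC -!scalerA -scalerDr uinZr ?ltW//.
by rewrite /r mulrC ltr_pdivrMr// mul1r.
Qed.

(** If the pair U, V fixes the interior point of the segment but moves B, then
    A - U B V is a proper convex combination of A - B and U (A - B) V, two
    distinct matrices of the same norm, and strict convexity contradicts
    minimality. *)
Lemma orbit_local_min_stab (t : R) A B : orbit_local_min A B -> 0 < t < 1 ->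
  exists2 e : R, 0 < e & forall U V, U \is unitarymx -> V \is unitarymx ->
    U *m ((1 - t)%:C *: A + t%:C *: B) *m V = (1 - t)%:C *: A + t%:C *: B ->
    N (U *m B *m V - B) < e -> U *m B *m V = B.
Proof.
move=> [e e0 eP] t01; exists e => // U V uU uV.
set G := _ + _ => UGV small.
set X := A - B.
(* This only uses A = (G - t B) / (1 - t). *)
have XE : A - U *m B *m V = t%:C *: X + (1 - t)%:C *: (U *m X *m V).
  have UAV : (1 - t)%:C *: (U *m A *m V) = G - t%:C *: (U *m B *m V).
    rewrite -{1}UGV /G mulmxDr mulmxDl -!scalemxAr -!scalemxAl.
    by rewrite addrK.
  rewrite /X mulmxBr mulmxBl !scalerBr UAV /G.
  apply/matrixP => i j; rewrite !mxE rmorphB rmorph1; ring.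
have [XX|neq] := pselect (X = U *m X *m V).
  have XE' := XE; rewrite -XX -scalerDl in XE'.
  rewrite (_ : t%:C + (1 - t)%:C = 1) in XE'; last by rewrite -rmorphD addrC subrK.
  rewrite scale1r in XE'.
  by move: XE' => /addrI/oppr_inj.
have := eP U V uU uV small; rewrite XE leNgt => /negP[].
by apply: uin_strict t01 => //; rewrite (hUI X uU uV).
Qed.

End UnitarilyInvariantNorm.

(** * Unit complex numbers *)

Section UnitComplex.
Variable R : realType.
Local Notation normc := ComplexField.Normc.normc.

(** The rational parametrization (1 + i t)^2 / (1 + t^2) of the unit circle,
    used to move away from 1 with explicit control of the distance. *)
Definition cayley (t : R) : R[i] :=
  ((1 - t ^+ 2) / (1 + t ^+ 2)) +i* (2 * t / (1 + t ^+ 2)).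

Lemma cayley_den (t : R) : 1 + t ^+ 2 != 0.
Proof. by rewrite gt_eqF// ltr_pwDl// sqr_ge0. Qed.

Lemma cayley_unit t : cayley t * Num.conj (cayley t) = 1.
Proof.
have dn := cayley_den t.
apply/eqP; rewrite eq_complex /=; apply/andP; split; apply/eqP; field => //.
Qed.

Lemma cayley_near1 t : normc (cayley t - 1) <= 2 * `|t|.
Proof.
have dn := cayley_den t; have d1 : 1 <= 1 + t ^+ 2 by rewrite lerDl sqr_ge0.
rewrite -(@ler_pXn2r _ 2) ?nnegrE ?mulr_ge0//; last exact: sqrtr_ge0.
rewrite /= sqr_sqrtr ?addr_ge0 ?sqr_ge0// exprMn real_normK ?num_real//.
have -> : ((1 - t ^+ 2) / (1 + t ^+ 2) - 1) ^+ 2 + (2 * t / (1 + t ^+ 2) - 0) ^+ 2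
   = 2 ^+ 2 * t ^+ 2 / (1 + t ^+ 2) by field.
by rewrite ler_pdivrMr ?(lt_le_trans ltr01)// ler_peMr// mulr_ge0// sqr_ge0.
Qed.

Lemma cayley_neq1 t : t != 0 -> cayley t != 1.
Proof.
move=> t0; rewrite eq_complex negb_and /=; apply/orP; right.
by rewrite mulf_neq0 ?invr_eq0 ?cayley_den// mulf_neq0// pnatr_eq0.
Qed.

Lemma Re_cayleyM t (w : R[i]) :
  complex.Re (cayley t * w) =
  complex.Re w - 2 * t * (t * complex.Re w + complex.Im w) / (1 + t ^+ 2).
Proof.
by case: w => a b /=; have dn := cayley_den t; field.
Qed.

(** Unless w is a nonnegative real, some arbitrarily small rotation increases its
    real part: the increase has the sign of - t (t Re w + Im w).  If Im w = 0,
    then Re w < 0 and any t works; otherwise t has the sign opposite to that of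
    Im w and is small enough for Im w to dominate t Re w. *)
Lemma cayley_Re_gt (w : R[i]) (e : R) : 0 < e -> ~~ (0 <= w) ->
  exists2 t, `|t| < e & complex.Re w < complex.Re (cayley t * w).
Proof.
case: w => a b e0 w0; have {}w0 : (b != 0) || ~~ (0 <= a).
  by move: w0; rewrite lecE /= negb_and.
suff [t te tw] : exists2 t, `|t| < e & t * (t * a + b) < 0.
  exists t => //; rewrite Re_cayleyM /= ltrDl oppr_gt0 pmulr_llt0.
    by rewrite -mulrA pmulr_rlt0.
  by rewrite invr_gt0 ltr_pwDl// sqr_ge0.
have [b0|b0] := eqVneq b 0.
  move: w0; rewrite b0 eqxx /= -ltNge => a0.
  exists (e / 2).
    by rewrite ger0_norm ?ltW ?divr_gt0// ltr_pdivrMr// ltr_pMr// ltr1n.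
  by rewrite addr0 mulrA -expr2 pmulr_rlt0// exprn_gt0// divr_gt0.
pose r := Num.min (e / 2) (`|b| / (2 * (1 + `|a|))).
have a1 : 0 < 1 + `|a| by rewrite ltr_pwDl.
have r0 : 0 < r by rewrite lt_min !divr_gt0// ?mulr_gt0// normr_gt0.
have re : r < e.
  apply: (@le_lt_trans _ _ (e / 2)); first by rewrite ge_min lexx.
  by rewrite ltr_pdivrMr// ltr_pMr// ltr1n.
have rb : r * `|a| < `|b|.
  have : r <= `|b| / (2 * (1 + `|a|)) by rewrite ge_min lexx orbT.
  rewrite ler_pdivlMr ?mulr_gt0// => h; apply: lt_le_trans h.
  by rewrite ltr_pM2l//; have := normr_ge0 a; lra.
exists (- (Num.sg b * r)).
  rewrite normrN normrM normr_sg b0 mul1r ger0_norm//; exact: ltW.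
have bE : b = Num.sg b * `|b| by rewrite -numEsg.
have s2 : Num.sg b * Num.sg b = 1 by rewrite -expr2 sqr_sg b0.
have -> : - (Num.sg b * r) * (- (Num.sg b * r) * a + b)
   = r * (r * a * (Num.sg b * Num.sg b) - Num.sg b * b) by ring.
rewrite s2 mulr1 -normrEsg pmulr_rlt0// subr_lt0; apply: le_lt_trans rb.
by apply: ler_wpM2l; [exact: ltW|exact: ler_norm].
Qed.

Lemma unit_polar (q : R[i]) : exists2 u : R[i], u * Num.conj u = 1 & q = (normc q)%:C * u.
Proof.
have [->|q0] := eqVneq q 0.
  by exists 1; rewrite ?rmorph1 ?mulr1// ComplexField.Normc.normc0.
have n0 : normc q != 0 by apply: contra_neq q0 => /ComplexField.Normc.eq0_normc.
have nC : (normc q)%:C != 0 :> R[i] by rewrite eq_complex /= eqxx andbT.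
exists (q / (normc q)%:C); last by rewrite mulrC divfK.
rewrite rmorphM fmorphV /= mulrACA -invfM.
have -> : q * Num.conj q = (normc q)%:C * Num.conj (normc q)%:C.
  case: q {q0 n0 nC} => a b /=; set r := Num.sqrt _.
  have r2 : r ^+ 2 = a ^+ 2 + b ^+ 2 by rewrite sqr_sqrtr ?addr_ge0 ?sqr_ge0.
  apply/eqP; rewrite eq_complex /=; apply/andP; split; apply/eqP; last by ring.
  by transitivity (r ^+ 2); [rewrite r2|]; ring.
by rewrite divff// mulf_neq0//; rewrite fmorph_eq0.
Qed.

End UnitComplex.

(** * Minimizers in diagonal position *)

Section DiagonalForm.
Variables (R : realType) (d : nat) (N : 'M[R[i]]_d -> R).
Hypotheses (hN : is_norm N) (hUI : unitarily_invariant N) (hSC : strictly_convex N).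
Implicit Types (A B : 'M[R[i]]_d) (g : 'rV[R[i]]_d) (i j : 'I_d).
Local Notation normc := ComplexField.Normc.normc.

Lemma phaseE i (z w : R[i]) B k l :
  (phase i z *m B *m phase i w) k l =
  (if k == i then z else 1) * B k l * (if l == i then w else 1).
Proof. by rewrite mul_mx_diag mxE mul_diag_mx !mxE. Qed.

Lemma phase_close i B : exists2 K : R, 0 < K & forall z w : R[i],
  w * Num.conj w = 1 ->
  N (phase i z *m B *m phase i w - B) <= K * (normc (z - 1) + normc (w - 1)).
Proof.
pose E : 'M[R[i]]_d := delta_mx i i.
have K0 : 0 < 1 + (N (E *m B) + N (B *m E)) by rewrite ltr_pwDl// addr_ge0 ?uin_ge0.
exists (1 + (N (E *m B) + N (B *m E))) => // z w w1.
have uw := phase_unitary i w1.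
have -> : phase i z *m B *m phase i w - B =
    (z - 1) *: (E *m B *m phase i w) + (w - 1) *: (B *m E).
  rewrite {1}phase_delta mulmxDl mul1mx mulmxDl -!scalemxAl addrAC addrC.
  congr (_ + _); rewrite phase_delta mulmxDr mulmx1 addrAC subrr add0r.
  by rewrite -scalemxAr.
apply: (le_trans (uinD hN _ _)); rewrite !(uinZ hN) (uinUr hUI _ uw).
have nz (a : R[i]) : 0 <= normc a by case: a => a b; exact: sqrtr_ge0.
have e1 := uin_ge0 hN (E *m B); have e2 := uin_ge0 hN (B *m E).
have := nz (z - 1); have := nz (w - 1).
move: (normc (z - 1)) (normc (w - 1)) => p q q0 p0.
rewrite mulrDr; apply: lerD; rewrite [leRHS]mulrC; apply: ler_wpM2l => //.
  by rewrite addrCA lerDl addr_ge0.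
by rewrite addrA lerDr addr_ge0.
Qed.

Lemma phase_cayley_close i B (e : R) : 0 < e ->
  exists2 r : R, 0 < r & forall t (w : R[i]), `|t| < r ->
    w * Num.conj w = 1 -> normc (w - 1) <= 2 * `|t| ->
    N (phase i (cayley t) *m B *m phase i w - B) < e.
Proof.
move=> e0; have [K K0 KP] := phase_close i B.
(* The factor 4 accounts for the two distances to 1, each at most 2 |t|. *)
exists (e / (K * 4)) => [|t w]; first by rewrite divr_gt0// mulr_gt0.
rewrite ltr_pdivlMr ?mulr_gt0// => te w1 wt.
apply: le_lt_trans (KP _ _ w1) _; apply: le_lt_trans te.
rewrite [leRHS]mulrC -mulrA; apply: ler_wpM2l; first exact: ltW.
by have := cayley_near1 t; lra.
Qed.

(** Conjugation by phase i z fixes the diagonal matrix G, hence B when z is near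
    1, while it multiplies the off-diagonal entries of row i by z <> 1. *)
Lemma stab_diag (t : R) A B g : orbit_local_min N A B -> 0 < t < 1 ->
  (1 - t)%:C *: A + t%:C *: B = diag_mx g ->
  forall i j, i != j -> B i j = 0.
Proof.
move=> lmB t01 GE i j ij.
have [e e0 stab] := orbit_local_min_stab hN hUI hSC lmB t01.
have [r r0 close] := phase_cayley_close i B e0.
pose z : R[i] := cayley (r / 2).
have z1 : z * Num.conj z = 1 := cayley_unit _.
have w1 : Num.conj z * Num.conj (Num.conj z) = 1 by rewrite conjCK mulrC.
have zn1 : z != 1 by apply: cayley_neq1; rewrite gt_eqF// divr_gt0.
have fixG : phase i z *m diag_mx g *m phase i (Num.conj z) = diag_mx g.
  apply/matrixP => k l; rewrite phaseE !mxE.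
  have [->|kl] := eqVneq k l; last by rewrite mulr0 mul0r.
  by case: eqP => _; rewrite ?mul1r ?mulr1// mulrAC z1 mul1r.
have near : N (phase i z *m B *m phase i (Num.conj z) - B) < e.
  apply: close => //.
    by rewrite gtr0_norm ?divr_gt0// ltr_pdivrMr// ltr_pMr// ltr1n.
  have -> : Num.conj z - 1 = Num.conj (z - 1) by rewrite rmorphB rmorph1.
  have -> : normc (Num.conj (z - 1)) = normc (z - 1).
    by case: (z - 1) => a b /=; rewrite sqrrN.
  exact: cayley_near1.
have := stab _ _ (phase_unitary i z1) (phase_unitary i w1).
rewrite GE => /(_ fixG near)/matrixP/(_ i j).
rewrite phaseE eqxx eq_sym (negPf ij) mulr1 => zB.
have /eqP : (z - 1) * B i j = 0 by rewrite mulrBl mul1r zB subrr.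
by rewrite mulf_eq0 subr_eq0 (negPf zn1) => /eqP.
Qed.

(** Writing q = r u with u of modulus 1, the factor q is the convex combination
    of u and - u with weight (1 + r) / 2 on u. *)
Lemma phase_contract i (q : R[i]) g : normc q < 1 -> g 0 i != 0 ->
  N (phase i q *m diag_mx g) < N (diag_mx g).
Proof.
move=> q1 gi; have [u u1 qE] := unit_polar q; set r := normc q in q1 qE.
have r0 : 0 <= r by rewrite /r; case: (q) => a b; exact: sqrtr_ge0.
have nu1 : - u * Num.conj (- u) = 1 by rewrite rmorphN mulrNN.
pose t := (1 + r) / 2.
have t01 : 0 < t < 1 by rewrite /t; apply/andP; split; lra.
have -> : phase i q *m diag_mx g =
    t%:C *: (phase i u *m diag_mx g) + (1 - t)%:C *: (phase i (- u) *m diag_mx g).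
  apply/matrixP => k l; rewrite !mul_diag_mx !mxE mulrA [X in _ + X]mulrA -mulrDl.
  congr (_ * _); have tE : (1 - t)%:C = 1 - t%:C :> R[i] by rewrite rmorphB rmorph1.
  case: eqP => _; rewrite tE; last by ring.
  have -> : q = (t%:C + t%:C - 1) * u.
    rewrite qE; congr (_ * _); rewrite -rmorphD -(rmorph1 (real_complex R)) -rmorphB.
    by congr (_%:C); rewrite /t; field.
  by ring.
have uu := phase_unitary i u1; have unu := phase_unitary i nu1.
rewrite -(uinUl hUI (diag_mx g) uu); apply: (uin_strict hN hSC _ _ t01).
  by rewrite (uinUl hUI _ uu) (uinUl hUI _ unu).
move/matrixP/(_ i i); rewrite !mul_diag_mx !mxE eqxx mulr1n => /(mulIf gi).
move/eqP; rewrite -subr_eq0 opprK -mulr2n mulrn_eq0 /= => /eqP u0.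
by move/eqP: u1; rewrite u0 mul0r eq_sym oner_eq0.
Qed.

Lemma normc_lt_rotate (z a b : R[i]) : z * Num.conj z = 1 ->
  complex.Re (Num.conj a * b) < complex.Re (z * (Num.conj a * b)) ->
  normc (a - z * b) < normc (a - b).
Proof.
case: z a b => x y [a1 a2] [b1 b2] /eqP; rewrite eq_complex /= => /andP[/eqP xy _] h.
have xy1 : x ^+ 2 + y ^+ 2 = 1 by rewrite -[RHS]xy; ring.
have E : (x ^+ 2 + y ^+ 2) * (b1 ^+ 2 + b2 ^+ 2) = b1 ^+ 2 + b2 ^+ 2 by rewrite xy1 mul1r.
have lt2 : (a1 - (x * b1 - y * b2)) ^+ 2 + (a2 - (x * b2 + y * b1)) ^+ 2 <
       (a1 - b1) ^+ 2 + (a2 - b2) ^+ 2.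
  by move: h E; nra.
by rewrite ltr_sqrt// (le_lt_trans _ lt2)// addr_ge0 ?sqr_ge0.
Qed.

(** Since |a - z b|^2 = |a|^2 + |b|^2 - 2 Re (z conj(a) b) for |z| = 1, a phase
    mismatch at i lets a small rotation z of b_i shrink the i-th entry of the
    difference and keep the others; phase_contract turns this into a decrease
    of N. *)
Lemma diag_same_phase (a b : 'rV[R[i]]_d) :
  orbit_local_min N (diag_mx a) (diag_mx b) -> forall i, 0 <= Num.conj (a 0 i) * b 0 i.
Proof.
move=> [e e0 lm] i; apply/negPn/negP => w0.
have [r r0 close] := phase_cayley_close i (diag_mx b) e0.
have [t tr tw] := cayley_Re_gt r0 w0; set z := cayley t in tw.
have z1 : z * Num.conj z = 1 := cayley_unit t.
have := normc_lt_rotate z1 tw.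
set p := a 0 i - z * b 0 i; set x := a 0 i - b 0 i => px.
have np : 0 <= normc p by case: (p) => ? ?; exact: sqrtr_ge0.
have nx : 0 < normc x := le_lt_trans np px.
have x0 : x != 0.
  by apply: contraTneq nx => ->; rewrite ComplexField.Normc.normc0 ltxx.
have q1 : normc (p / x) < 1.
  by rewrite ComplexField.Normc.normcM ComplexField.Normc.normcV ltr_pdivrMr// mul1r.
have one1 : (1 : R[i]) * Num.conj 1 = 1 by rewrite rmorph1 mulr1.
have c1 : normc (1 - 1) <= 2 * `|t|.
  by rewrite subrr ComplexField.Normc.normc0 mulr_ge0.
have := lm _ _ (phase_unitary i z1) (phase_unitary i one1) (close t 1 tr one1 c1).
have -> : diag_mx a - phase i z *m diag_mx b *m phase i 1
    = phase i (p / x) *m diag_mx (a - b).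
  apply/matrixP => k l; rewrite 2!mxE [X in _ + X]mxE phaseE mul_diag_mx !mxE.
  have [<-|kl] := eqVneq k l; last by rewrite !(mulr0, mul0r) subrr.
  have [->|ki] := eqVneq k i; last by rewrite !(mul1r, mulr1) !mulr1n.
  by rewrite !mulr1n mulr1 divfK.
have -> : diag_mx a - diag_mx b = diag_mx (a - b) by rewrite linearB.
rewrite leNgt => /negP; apply; apply: phase_contract => //.
by rewrite !mxE.
Qed.

(** The reflection 1 - 2 w^T w / (w w^T) with w = e_i + 2 e_j: it mixes the
    coordinates i and j, hence commutes with the diagonal matrices having equal
    entries there, and the unequal weights 1 and 2 make it create an
    off-diagonal entry for all the others. *)
Lemma plane_reflection i j : i != j -> exists H : 'M[R[i]]_d,
  [/\ H \is unitarymx,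
      forall g : 'rV[R]_d, g 0 i = g 0 j -> H *m Dmx g *m H = Dmx g
    & forall b : 'rV[R]_d,
      (H *m Dmx b *m H) i j = (12 / 25) * ((b 0 j)%:C - (b 0 i)%:C)].
Proof.
move=> ij; pose w : 'rV[R[i]]_d := delta_mx 0 i + 2 *: delta_mx 0 j.
pose c : R[i] := 2 / 5.
pose M := w^T *m w; pose H : 'M[R[i]]_d := 1%:M - c *: M.
have wiE : w 0 i = 1 by rewrite !mxE !eqxx (negPf ij) mulr0 addr0.
have wjE : w 0 j = 2 by rewrite !mxE !eqxx eq_sym (negPf ij) mulr1 add0r.
have w0E k : k != i -> k != j -> w 0 k = 0.
  by move=> ki kj; rewrite !mxE eqxx (negPf ki) (negPf kj) mulr0 addr0.
have wD (x : 'rV[R]_d) :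
    w *m Dmx x *m w^T = ((x 0 i)%:C + 4 * (x 0 j)%:C)%:M.
  apply/matrixP => k l; rewrite !ord1 mxE [RHS]mxE mulr1n.
  have entry m : (w *m Dmx x) 0 m * w^T m 0 = w 0 m ^+ 2 * (x 0 m)%:C.
    by rewrite mul_mx_diag [X in X * _]mxE [w^T m 0]mxE [map_mx _ _ 0 m]mxE; ring.
  under eq_bigr do rewrite entry.
  rewrite (bigD1 i)// (bigD1 j)/=; last by rewrite eq_sym.
  rewrite big1 ?addr0 => [|m /andP[mi mj]]; last by rewrite w0E// expr0n mul0r.
  by rewrite wiE wjE; ring.
have ww : w *m w^T = 5%:M.
  have := wD (const_mx 1).
  rewrite /Dmx map_const_mx /= rmorph1 diag_const_mx mulmx1 => ->.
  by congr (_%:M); rewrite !mxE rmorph1; ring.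
have MM : M *m M = 5 *: M.
  rewrite /M mulmxA -[w^T *m w *m _]mulmxA ww.
  by rewrite -scalemx1 -scalemxAr mulmx1 -scalemxAl.
have HH : H *m H = 1%:M.
  rewrite /H mulmxBl mul1mx mulmxBr mulmx1 -scalemxAl -scalemxAr MM !scalerA.
  have -> : c * c * 5 = c + c by rewrite /c; field.
  by rewrite scalerDl opprB addrK subrK.
have wr : map_mx Num.conj w = w.
  by apply/rowP => k; rewrite !mxE rmorphD rmorphM /= !rmorph_nat.
have Hh : H^t* = H.
  rewrite /H /M linearB linearZ /= trmx1 map_mxB map_mxZ map_mx1 trmx_mul trmxK.
  rewrite map_mxM -map_trmx wr; congr (_ - _ *: _).
  by rewrite /c rmorphM fmorphV !rmorph_nat.
exists H; split=> [|g gij|b].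
- by apply/unitarymxP; rewrite Hh.
- have wg : w *m Dmx g = (g 0 i)%:C *: w.
    apply/rowP => k; rewrite mul_mx_diag mxE [map_mx _ _ 0 k]mxE [RHS]mxE.
    have [->|ki] := eqVneq k i; first by rewrite mulrC.
    have [->|kj] := eqVneq k j; first by rewrite gij mulrC.
    by rewrite w0E// mul0r mulr0.
  have gw : Dmx g *m w^T = (g 0 i)%:C *: w^T.
    by rewrite -linearZ -wg /= trmx_mul /Dmx tr_diag_mx.
  have comm : H *m Dmx g = Dmx g *m H.
    rewrite /H /M mulmxBl mulmxBr mul1mx mulmx1 -scalemxAl -scalemxAr -mulmxA wg.
    by rewrite [Dmx g *m _]mulmxA gw -scalemxAl -scalemxAr.
  by rewrite comm -mulmxA HH mulmx1.
have MbM : M *m Dmx b *m M = ((b 0 i)%:C + 4 * (b 0 j)%:C) *: M.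
  rewrite /M !mulmxA -[w^T *m w *m _]mulmxA -[w^T *m _ *m _]mulmxA wD.
  by rewrite -scalemx1 -scalemxAr mulmx1 -scalemxAl.
have HbH : H *m Dmx b *m H = (Dmx b - c *: (Dmx b *m M))
    - c *: (M *m Dmx b) + c *: (c *: (((b 0 i)%:C + 4 * (b 0 j)%:C) *: M)).
  rewrite /H mulmxBr mulmx1 mulmxBl mul1mx -scalemxAl -scalemxAr mulmxBl.
  by rewrite -scalemxAl MbM; apply/matrixP => k l; rewrite !mxE; ring.
have Mij : M i j = 2 by rewrite mxE big_ord1 mxE wiE wjE mul1r.
have bM : (Dmx b *m M) i j = (b 0 i)%:C * 2 by rewrite mul_diag_mx mxE Mij mxE.
have Mb : (M *m Dmx b) i j = 2 * (b 0 j)%:C by rewrite mul_mx_diag mxE Mij mxE.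
have Dij : Dmx b i j = 0 by rewrite mxE (negPf ij).
have entry (X Y Z T : 'M[R[i]]_d) (p q : R[i]) :
    (X - p *: Y - p *: Z + p *: (p *: (q *: T))) i j
    = X i j - p * Y i j - p * Z i j + p * (p * (q * T i j)).
  by rewrite !mxE.
by rewrite HbH entry bM Mb Dij Mij /c; field.
Qed.

(** If b_i > b_j while a_i < a_j, the difference of the coordinates i and j
    changes sign along the segment, hence vanishes at an interior point g.  The
    reflection H leaves g diagonal, so H B H would be diagonal too, and then
    b_i = b_j. *)
Lemma diag_same_order (a b : 'rV[R]_d) :
  orbit_local_min N (Dmx a) (Dmx b) ->
  forall i j, a 0 i < a 0 j -> b 0 i <= b 0 j.
Proof.
move=> lm i j aij; rewrite leNgt; apply/negP => bij.
have ij : i != j by apply: contraTneq aij => ->; rewrite ltxx.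
pose S := (a 0 j - a 0 i) + (b 0 i - b 0 j).
have S0 : 0 < S by rewrite addr_gt0 ?subr_gt0.
(* The parameter at which the coordinates i and j of (1 - t) a + t b agree. *)
pose t := (a 0 j - a 0 i) / S.
have t01 : 0 < t < 1.
  by rewrite divr_gt0 ?subr_gt0//= ltr_pdivrMr// mul1r /S ltrDl subr_gt0.
pose g : 'rV[R]_d := (1 - t) *: a + t *: b.
have gij : g 0 i = g 0 j.
  rewrite !mxE; apply/eqP; rewrite -subr_eq0; apply/eqP.
  have -> : 1 - t = (b 0 i - b 0 j) / S by rewrite /t /S; field; exact: lt0r_neq0.
  by rewrite /t; field; exact: lt0r_neq0.
have [H [uH fixH entryH]] := plane_reflection ij.
have gD : (1 - t)%:C *: Dmx a + t%:C *: Dmx b = Dmx g.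
  apply/esym/matrixP => k l; rewrite !mxE rmorphD !rmorphM /=.
  by case: eqP => _; rewrite ?mulr1n ?mulr0n ?mulr0 ?addr0.
have gE : (1 - t)%:C *: (H *m Dmx a *m H) + t%:C *: (H *m Dmx b *m H) = Dmx g.
  transitivity (H *m ((1 - t)%:C *: Dmx a + t%:C *: Dmx b) *m H).
    by rewrite mulmxDr mulmxDl -!scalemxAr -!scalemxAl.
  exact: (etrans (congr1 (fun X => H *m X *m H) gD) (fixH g gij)).
have := stab_diag (orbit_local_min_unitary hUI uH uH lm) t01 gE ij.
have c0 : 12 / 25 != 0 :> R[i] by rewrite mulf_neq0 ?invr_eq0 ?pnatr_eq0.
rewrite entryH => /eqP; rewrite mulf_eq0 (negPf c0) subr_eq0 => /eqP/complexI ji.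
by move: bij; rewrite ji ltxx.
Qed.

End DiagonalForm.

(** * Compactness of the unitary group *)

Section Compactness.
Variables (R : realType) (d : nat) (N : 'M[R[i]]_d -> R).
Hypothesis hN : is_norm N.
Implicit Types (A D U V X : 'M[R[i]]_d).
Local Notation normc := ComplexField.Normc.normc.

Section Continuity.
Variable T : topologicalType.
Implicit Types (f g : T -> R[i]) (F G : T -> 'M[R[i]]_d).

(** Continuity of complex-valued maps is tested on coordinates, which keeps all
    limits in the real line. *)
Definition ccontinuous f :=
  continuous (fun t => complex.Re (f t)) /\ continuous (fun t => complex.Im (f t)).

Lemma ccontinuousD f g : ccontinuous f -> ccontinuous g ->
  ccontinuous (fun t => f t + g t).
Proof.
move=> [f1 f2] [g1 g2]; split=> t.
  rewrite (_ : (fun _ => _) = (fun t => complex.Re (f t) + complex.Re (g t))).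
    by apply: cvgD; [exact: f1|exact: g1].
  by apply/funext => u; case: (f u) (g u) => ? ? [].
rewrite (_ : (fun _ => _) = (fun t => complex.Im (f t) + complex.Im (g t))).
  by apply: cvgD; [exact: f2|exact: g2].
by apply/funext => u; case: (f u) (g u) => ? ? [].
Qed.

Lemma ccontinuousM f g : ccontinuous f -> ccontinuous g ->
  ccontinuous (fun t => f t * g t).
Proof.
move=> [f1 f2] [g1 g2]; split=> t.
  rewrite (_ : (fun _ => _) = (fun t => complex.Re (f t) * complex.Re (g t)
                                    - complex.Im (f t) * complex.Im (g t))).
    by apply: cvgB; apply: cvgM; [exact: f1|exact: g1|exact: f2|exact: g2].
  by apply/funext => u; case: (f u) (g u) => ? ? [].
rewrite (_ : (fun _ => _) = (fun t => complex.Re (f t) * complex.Im (g t)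
                                    + complex.Im (f t) * complex.Re (g t))).
  by apply: cvgD; apply: cvgM; [exact: f1|exact: g2|exact: f2|exact: g1].
by apply/funext => u; case: (f u) (g u) => ? ? [].
Qed.

Lemma ccontinuous_conj f : ccontinuous f -> ccontinuous (fun t => Num.conj (f t)).
Proof.
move=> [f1 f2]; split=> t.
  rewrite (_ : (fun _ => _) = (fun t => complex.Re (f t))); first exact: f1.
  by apply/funext => u; case: (f u).
rewrite (_ : (fun _ => _) = (fun t => - complex.Im (f t))).
  by apply: cvgN; exact: f2.
by apply/funext => u; case: (f u).
Qed.

Lemma ccontinuous_cst (z : R[i]) : ccontinuous (fun=> z).
Proof. by split=> t; exact: cst_continuous. Qed.

Lemma ccontinuous_sum n (f : 'I_n -> T -> R[i]) :
  (forall i, ccontinuous (f i)) -> ccontinuous (fun t => \sum_i f i t).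
Proof.
move=> cf; elim: (index_enum _) => [|i r IHr].
  rewrite (_ : (fun _ => _) = (fun=> 0)); first exact: ccontinuous_cst.
  by apply/funext => t; rewrite big_nil.
rewrite (_ : (fun _ => _) = (fun t => f i t + \sum_(j <- r) f j t)).
  by apply: ccontinuousD IHr; exact: cf.
by apply/funext => t; rewrite big_cons.
Qed.

Definition mcontinuous F := forall i j, ccontinuous (fun t => F t i j).

Lemma mcontinuous_cst A : mcontinuous (fun=> A).
Proof. by move=> i j; exact: ccontinuous_cst. Qed.

Lemma mcontinuousB F G : mcontinuous F -> mcontinuous G ->
  mcontinuous (fun t => F t - G t).
Proof.
move=> cF cG i j.
rewrite (_ : (fun _ => _) = (fun t => F t i j + (-1) * G t i j)).
  by apply: ccontinuousD => //; apply: ccontinuousM => //; exact: ccontinuous_cst.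
by apply/funext => t; rewrite !mxE mulN1r.
Qed.

Lemma mcontinuousM F G : mcontinuous F -> mcontinuous G ->
  mcontinuous (fun t => F t *m G t).
Proof.
move=> cF cG i j.
rewrite (_ : (fun _ => _) = (fun t => \sum_k F t i k * G t k j)).
  by apply: ccontinuous_sum => k; exact: ccontinuousM.
by apply/funext => t; rewrite mxE.
Qed.

Lemma mcontinuous_adj F : mcontinuous F -> mcontinuous (fun t => (F t)^t*).
Proof.
move=> cF i j.
rewrite (_ : (fun _ => _) = (fun t => Num.conj (F t j i))).
  exact: ccontinuous_conj.
by apply/funext => t; rewrite !mxE.
Qed.

Lemma uin_le_sum X :
  N X <= \sum_i \sum_j (`|complex.Re (X i j)| + `|complex.Im (X i j)|) * N (delta_mx i j).
Proof.
have Nsum n (Y : 'I_n -> 'M[R[i]]_d) : N (\sum_i Y i) <= \sum_i N (Y i).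
  apply: (big_ind2 (fun Z r => N Z <= r)) => // [|Z1 r1 Z2 r2 h1 h2].
    by rewrite (uin0 hN).
  by apply: le_trans (uinD hN _ _) _; exact: lerD.
rewrite {1}(matrix_sum_delta X); apply: le_trans (Nsum _ _) _.
apply: ler_sum => i _; apply: le_trans (Nsum _ _) _; apply: ler_sum => j _.
rewrite (uinZ hN); apply: ler_wpM2r; first exact: uin_ge0.
case: (X i j) => a b /=.
rewrite -(@ler_pXn2r _ 2) ?nnegrE ?sqrtr_ge0 ?addr_ge0//.
rewrite sqr_sqrtr ?addr_ge0 ?sqr_ge0// sqrrD !real_normK ?num_real//.
by rewrite lerD2r lerDl mulrn_wge0// mulr_ge0.
Qed.

(** A norm is Lipschitz for the sum of the moduli of the coordinates. *)
Lemma uin_continuous F : mcontinuous F -> continuous (fun t => N (F t)).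
Proof.
move=> cF t0; pose h t := \sum_i \sum_j (`|complex.Re ((F t - F t0) i j)|
   + `|complex.Im ((F t - F t0) i j)|) * N (delta_mx i j).
have Nh t : `|N (F t0) - N (F t)| <= h t.
  have sym : N (F t0 - F t) = N (F t - F t0) by rewrite -(uinN hN) opprB.
  apply: le_trans (uin_le_sum _).
  rewrite ler_norml lerBrDl lerBlDl; apply/andP; split.
    have := uinD hN (F t - F t0) (F t0); rewrite subrK addrC; lra.
  by have := uinD hN (F t0 - F t) (F t); rewrite subrK sym addrC; lra.
have ch : h t @[t --> t0] --> (0 : R).
  have h0 : 0 = h t0.
    rewrite /h big1// => i _; rewrite big1// => j _.
    by rewrite subrr mxE /= normr0 addr0 mul0r.
  rewrite [X in _ --> X]h0.
  apply: (cvg_big (op := +%R)) => [|i _]; first exact: add_continuous.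
  apply: (cvg_big (op := +%R)) => [|j _]; first exact: add_continuous.
  apply: cvgM; last exact: cvg_cst.
  have [c1 c2] : ccontinuous (fun t => (F t - F t0) i j).
    by apply: mcontinuousB => //; exact: mcontinuous_cst.
  by apply: cvgD; apply: cvg_norm; [exact: c1|exact: c2].
apply/cvgrPdist_le => e e0; move/cvgrPdist_lt : ch => /(_ e e0).
apply: filterS => t; rewrite sub0r normrN => ht; apply: le_trans (Nh t) _.
exact: le_trans (ler_norm _) (ltW ht).
Qed.

End Continuity.

Lemma unitary_entry_le1 (U : 'M[R[i]]_d) i j : U \is unitarymx ->
  `|complex.Re (U i j)| <= 1 /\ `|complex.Im (U i j)| <= 1.
Proof.
move=> /unitarymxP/matrixP/(_ i i); rewrite !mxE eqxx.
have E k : U i k * (U^t*) k i =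
    (complex.Re (U i k) ^+ 2 + complex.Im (U i k) ^+ 2)%:C.
  rewrite !mxE; case: (U i k) => a b; apply/eqP; rewrite eq_complex /=.
  by apply/andP; split; apply/eqP; ring.
under eq_bigr do rewrite E; rewrite -rmorph_sum /= => -[].
rewrite (bigD1 j)//=; set r := \sum_(_ | _) _.
set a := complex.Re _; set b := complex.Im _ => ab1.
have r0 : 0 <= r by apply: sumr_ge0 => k _; rewrite addr_ge0 ?sqr_ge0.
have := sqr_ge0 a; have := sqr_ge0 b => b0 a0.
split; rewrite -(@ler_pXn2r _ 2) ?nnegrE// expr1n real_normK ?num_real//.
  by move: ab1; lra.
by move: ab1; lra.
Qed.

(** Pairs of matrices are real families in the product topology, where Tychonoff
    applies in every dimension; the first index selects the matrix and the
    second one its real or imaginary part. *)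
Let Coord := (bool * bool * 'I_d * 'I_d)%type.
Let Space := prod_topology (fun _ : Coord => R).

Definition mx_of_coord (b : bool) (f : Space) : 'M[R[i]]_d :=
  \matrix_(i, j) (f (b, false, i, j) +i* f (b, true, i, j)).

Lemma mx_of_coord_continuous b : mcontinuous (mx_of_coord b).
Proof.
move=> i j; split=> f.
  rewrite (_ : (fun _ => _) = (@proj _ (fun _ : Coord => R) (b, false, i, j))).
    exact: proj_continuous.
  by apply/funext => g; rewrite mxE.
rewrite (_ : (fun _ => _) = (@proj _ (fun _ : Coord => R) (b, true, i, j))).
  exact: proj_continuous.
by apply/funext => g; rewrite mxE.
Qed.

Definition unitary_coord : set Space :=
  [set f | forall b, mx_of_coord b f \is unitarymx].

(** Unitary matrices form a closed set, the zero set of N (U U^* - 1), inside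
    the cube of coordinates between -1 and 1. *)
Lemma unitary_coord_compact : compact unitary_coord.
Proof.
apply: (@subclosed_compact _ _ [set f : Space | forall k, `[-1, 1]%classic (f k)]).
- rewrite (_ : unitary_coord = \bigcap_b (fun f =>
    N (mx_of_coord b f *m (mx_of_coord b f)^t* - 1%:M)) @^-1` [set x | x = 0]).
    apply: closed_bigI => b _; apply: preimage_closed; last exact: closed_eq.
    move=> f _; apply: uin_continuous; apply: mcontinuousB; last exact: mcontinuous_cst.
    apply: mcontinuousM; first exact: mx_of_coord_continuous.
    exact/mcontinuous_adj/mx_of_coord_continuous.
  apply/seteqP; split=> [f uf b _|f uf b] /=.
    by rewrite (unitarymxP (uf b)) subrr (uin0 hN).
  by apply/unitarymxP/eqP; rewrite -subr_eq0; apply/eqP/(uin_eq0 hN)/uf.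
- apply: (@tychonoff Coord (fun=> R) (fun=> `[-1, 1]%classic)) => k.
  exact: segment_compact.
move=> f uf [[[b c] i] j] /=; rewrite in_itv /= -ler_norml.
by have := unitary_entry_le1 i j (uf b); rewrite mxE /=; case: c => -[].
Qed.

Lemma unitary_orbit_min A D : exists U V, [/\ U \is unitarymx, V \is unitarymx &
  forall U' V', U' \is unitarymx -> V' \is unitarymx ->
    N (A - U *m D *m V) <= N (A - U' *m D *m V')].
Proof.
pose phi (f : Space) := N (A - mx_of_coord false f *m D *m mx_of_coord true f).
pose coord (U V : 'M[R[i]]_d) : Space := fun k =>
  let W := if k.1.1.1 then V else U in
  if k.1.1.2 then complex.Im (W k.1.2 k.2) else complex.Re (W k.1.2 k.2).
have coordK U V b : mx_of_coord b (coord U V) = if b then V else U.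
  apply/matrixP => i j; rewrite mxE /coord /=.
  by case: b; case: (_ i j).
have coordP U V : U \is unitarymx -> V \is unitarymx -> unitary_coord (coord U V).
  by move=> uU uV b; rewrite coordK; case: b.
have [||f uf fmin] := @compact_EVT_min _ R phi _ _ unitary_coord_compact.
- exists (coord 1%:M 1%:M); apply: coordP; exact: unitarymx1.
- apply: continuous_subspaceT; apply: uin_continuous.
  apply: mcontinuousB; first exact: mcontinuous_cst.
  apply: mcontinuousM; last exact: mx_of_coord_continuous.
  apply: mcontinuousM; [exact: mx_of_coord_continuous|exact: mcontinuous_cst].
move/set_mem in uf; exists (mx_of_coord false f), (mx_of_coord true f).
split; [exact: uf|exact: uf|].
move=> U V uU uV; have := fmin (coord U V); rewrite /phi !coordK; apply.
exact/mem_set/coordP.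
Qed.

End Compactness.

(** * Joint singular value decompositions *)

Section LocalMinimizers.
Variables (R : realType) (d : nat) (N : 'M[R[i]]_d -> R).
Hypotheses (hN : is_norm N) (hUI : unitarily_invariant N) (hSC : strictly_convex N).
Implicit Types (A B : 'M[R[i]]_d).

(** If a and b lie on a common ray, then so does a + b; that ray is the
    nonnegative half line, unless a + b = 0 and both numbers vanish. *)
Lemma conj_mul_add_ge0 (a b : R[i]) : 0 <= a + b -> 0 <= Num.conj a * b -> 0 <= a.
Proof.
case: a b => a1 a2 [b1 b2]; rewrite !lecE /= => /andP[/eqP im s0] /andP[/eqP im' re'].
have h1 : a2 + b2 = 0 by rewrite im.
have h2 : a1 * b2 - a2 * b1 = 0 by rewrite -im'; ring.
have h3 : 0 <= a1 * b1 + a2 * b2 by move: re'; lra.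
have b2E : b2 = - a2 by lra.
move: h2 h3; rewrite b2E => h2 h3.
have h2' : a2 * (a1 + b1) = 0 by move: h2; lra.
have [s00|sn0] := eqVneq (a1 + b1) 0.
  have b1E : b1 = - a1 by lra.
  move: h3; rewrite b1E => h3.
  have a10 : a1 = 0 by apply/eqP; rewrite -sqrf_eq0; apply/eqP; nra.
  have a20 : a2 = 0 by apply/eqP; rewrite -sqrf_eq0; apply/eqP; nra.
  by rewrite a10 a20 eqxx lexx.
have a20 : a2 = 0 by move/eqP: h2'; rewrite mulf_eq0 (negPf sn0) orbF => /eqP.
move: h3; rewrite a20 eqxx /= => h3.
by rewrite leNgt; apply/negP => a10; nra.
Qed.

(** The case where the midpoint is already its own singular value matrix. *)
Lemma orbit_local_min_diag A B (g : 'rV[R]_d) : orbit_local_min N A B ->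
  (forall i, 0 <= g 0 i) -> (forall i j : 'I_d, (i <= j)%N -> g 0 j <= g 0 i) ->
  (1 - 1 / 2)%:C *: A + (1 / 2)%:C *: B = Dmx g ->
  exists x y, [/\ A = Dmx x, B = Dmx y, singvals A = x & singvals B = y].
Proof.
move=> lm g0 g_noninc GE.
have half01 : 0 < (1 / 2 : R) < 1 by apply/andP; split; lra.
have B0 := stab_diag hN hUI hSC lm half01 GE.
have sumE i j : A i j + B i j = 2 * Dmx g i j.
  by rewrite -GE !mxE rmorphB rmorph1 fmorph_div /= rmorph_nat; field.
pose a := \row_i A i i; pose b := \row_i B i i.
have BE : B = diag_mx b.
  apply/matrixP => i j; rewrite !mxE; have [->|ij] := eqVneq i j => //.
  exact: B0.
have AE : A = diag_mx a.
  apply/matrixP => i j; have [->|ij] := eqVneq i j; first by rewrite !mxE eqxx.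
  by have := sumE i j; rewrite (B0 i j ij) !mxE (negPf ij) mulr0n addr0 mulr0.
have abE i : a 0 i + b 0 i = (2 * g 0 i)%:C.
  rewrite [a 0 i]mxE [b 0 i]mxE sumE !mxE eqxx mulr1n.
  by rewrite rmorphM rmorph_nat.
clearbody a b; subst A B.
have ab0 i : 0 <= a 0 i + b 0 i by rewrite abE ler0c mulr_ge0.
have phase_ab := diag_same_phase hN hUI hSC lm.
have a0 i : 0 <= a 0 i := conj_mul_add_ge0 (ab0 i) (phase_ab i).
have b0 i : 0 <= b 0 i.
  apply: (@conj_mul_add_ge0 _ (a 0 i)); first by rewrite addrC.
  by rewrite -conjC_ge0 rmorphM /= conjCK mulrC; exact: phase_ab.
pose x := \row_i complex.Re (a 0 i); pose y := \row_i complex.Re (b 0 i).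
have DxE : diag_mx a = Dmx x.
  by congr diag_mx; apply/rowP => i; rewrite [RHS]mxE [x 0 i]mxE RRe_real// ger0_real.
have DyE : diag_mx b = Dmx y.
  by congr diag_mx; apply/rowP => i; rewrite [RHS]mxE [y 0 i]mxE RRe_real// ger0_real.
have x0 i : 0 <= x 0 i by rewrite mxE; have := a0 i; rewrite lecE => /andP[].
have y0 i : 0 <= y 0 i by rewrite mxE; have := b0 i; rewrite lecE => /andP[].
rewrite DxE DyE in lm; have order := diag_same_order hN hUI hSC lm.
have xyE i : x 0 i + y 0 i = 2 * g 0 i.
  rewrite !mxE; have /(congr1 (@complex.Re R)) := abE i.
  by case: (a 0 i) (b 0 i) => ? ? [].
have xy_noninc (i j : 'I_d) : (i <= j)%N -> x 0 j + y 0 j <= x 0 i + y 0 i.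
  by move=> ij; rewrite !xyE ler_pM2l// g_noninc.
have x_noninc (i j : 'I_d) : (i <= j)%N -> x 0 j <= x 0 i.
  move=> /xy_noninc ij; rewrite leNgt; apply/negP => xij.
  by have := order _ _ xij; lra.
have y_noninc (i j : 'I_d) : (i <= j)%N -> y 0 j <= y 0 i.
  move=> /xy_noninc ij; rewrite leNgt; apply/negP => yij.
  have xij : x 0 j < x 0 i by lra.
  by have := order _ _ xij; lra.
have singvals_id (z : 'rV[R]_d) : (forall i, 0 <= z 0 i) ->
    (forall i j : 'I_d, (i <= j)%N -> z 0 j <= z 0 i) -> singvals (Dmx z) = z.
  move=> z0 z_noninc; have u1 := unitarymx1 R[i] d.
  by have := singvals_Dmx z u1 u1; rewrite mul1mx mulmx1 vabs_id// vdown_id.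
by exists x, y; rewrite DxE DyE !singvals_id.
Qed.

Lemma orbit_local_min_joint_svd A B : orbit_local_min N A B ->
  exists U V, [/\ U \is unitarymx, V \is unitarymx,
    A = U *m Dmx (singvals A) *m V & B = U *m Dmx (singvals B) *m V].
Proof.
move=> lmB; pose G := (1 - 1 / 2)%:C *: A + (1 / 2)%:C *: B.
have [U [V [uU uV GE]]] := svd G.
have uU' := adjmx_unitary uU; have uV' := adjmx_unitary uV.
have GD : (1 - 1 / 2)%:C *: (U^t* *m A *m V^t*) + (1 / 2)%:C *: (U^t* *m B *m V^t*)
    = Dmx (singvals G).
  transitivity (U^t* *m G *m V^t*).
    by rewrite mulmxDr mulmxDl -!scalemxAr -!scalemxAl.
  by rewrite {1}GE (unitary_equivK (Dmx (singvals G)) uU uV).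
have [x [y [AE BE]]] := orbit_local_min_diag
  (orbit_local_min_unitary hUI uU' uV' lmB) (singvals_ge0 G) (@singvals_noninc _ _ G) GD.
rewrite (singvals_unitary A uU' uV') (singvals_unitary B uU' uV') => sA sB.
exists U, V; split; [exact: uU|exact: uV|rewrite sA -AE|rewrite sB -BE].
  by rewrite (unitary_equivVK A uU uV).
by rewrite (unitary_equivVK B uU uV).
Qed.

Lemma DmxB (x y : 'rV[R]_d) : Dmx x - Dmx y = Dmx (x - y).
Proof. by rewrite /Dmx -linearB /= map_mxB. Qed.

Lemma orbit_local_min_dist A B : orbit_local_min N A B ->
  N (A - B) = N (Dmx (singvals A - singvals B)).
Proof.
move=> /orbit_local_min_joint_svd[U [V [uU uV AE BE]]].
rewrite {1}AE {1}BE -mulmxBl -mulmxBr DmxB; exact: (hUI _ uU uV).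
Qed.

End LocalMinimizers.

(** * Local minimizers on a singular value orbit *)

Theorem theorem3p12 (R : realType) (d : nat) (A : 'M[R[i]]_d) (s : 'rV[R]_d)
    (hs : nonneg_down s) (N : 'M[R[i]]_d -> R) (hN : is_norm N)
    (hUI : unitarily_invariant N) (hSC : strictly_convex N) (B : 'M[R[i]]_d)
    (hB : local_minimizer (Vset s) (fun C => N (A - C)) B) :
  (exists U V : 'M[R[i]]_d,
     [/\ U \is unitarymx, V \is unitarymx,
         A = U^t* *m Dmx (singvals A) *m V
       & B = U^t* *m Dmx (singvals B) *m V])
  /\ singvals (A - B) = vdown (vabs (singvals A - singvals B))
  /\ global_minimizer (Vset s) (fun C => N (A - C)) B.
Proof.
have lmB := local_minimizer_orbit hN hUI hB.
have [U [V [uU uV AE BE]]] := orbit_local_min_joint_svd hN hUI hSC lmB.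
have Bs : singvals B = s by case: hB.
split; [|split].
- exists (U^t*), V; rewrite trmxCK; split; [|exact: uV|exact: AE|exact: BE].
  exact: adjmx_unitary uU.
- by rewrite {1}AE {1}BE -mulmxBl -mulmxBr DmxB (singvals_Dmx _ uU uV).
split=> [|C Cs]; first exact: Bs.
have [P [Q [uP uQ PQmin]]] := unitary_orbit_min hN A (Dmx s).
pose M := P *m Dmx s *m Q.
have Ms : singvals M = s.
  transitivity (singvals (Dmx s)); first exact: (singvals_unitary (Dmx s) uP uQ).
  have := singvals_unitary (Dmx (singvals B)) uU uV; rewrite -BE Bs => <-; by [].
(* M minimizes the distance over the whole orbit, so any radius would do. *)
have lmM : orbit_local_min N A M.
  exists 1 => [|U' V' uU' uV' _]; first exact: ltr01.
  have := PQmin _ _ (mul_unitarymx uU' uP) (mul_unitarymx uQ uV').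
  by rewrite /M !mulmxA.
have [U' [V' [uU' uV' CE]]] := svd C.
have distB := orbit_local_min_dist hN hUI hSC lmB.
have distM := orbit_local_min_dist hN hUI hSC lmM.
rewrite Bs in distB; rewrite Ms in distM.
rewrite (etrans distB (esym distM)).
have := PQmin _ _ uU' uV'; rewrite -{2}(Cs : singvals C = s) -CE; exact.
Qed.
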